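(* Let $\mathbb{G}$ be a compact Lie group and let $\mathcal{L}$ be the Laplace-Beltrami operator on $\mathbb{G}$. Let $(u_0,u_1)\in H^1_{\mathcal{L}}(\mathbb{G})\times L^2(\mathbb{G})$ satisfy $$\int_{\mathbb{G}}u_j(x)\,\mathrm{d}x>0\qquad\text{for } j=0,1.$$ Let $p>1$ and let $\varphi:[0,+\infty)\to[0,+\infty)$, $\varphi\in L^1_{\mathrm{loc}}([0,+\infty))$, be a function satisfying the uniform upper scaling condition and such that $\varphi\notin L^1([0,+\infty))$. For $\varepsilon>0$, let $u$ be an energy solution to the Cauchy problem $$\begin{cases} \partial_t^2 u-\mathcal{L}u+\partial_t u=\varphi(t)|u|^p, & x\in\mathbb{G},\ t>0,\\ u(0,x)=\varepsilon u_0(x), & x\in\mathbb{G},\\ \partial_t u(0,x)=\varepsilon u_1(x), & x\in\mathbb{G},\end{cases}\qquad(\ast)$$ with lifespan $T=T(\varepsilon)$. Then $u$ blows up in finite time, i.e. $T(\varepsilon)<+\infty$. Moreover, if $\varphi$ is a positive function, then there exist $\varepsilon_0=\varepsilon_0(u_0,u_1,p,\varphi)>0$ and constants $c_2>1$, $C_2>0$ independent of $\varepsilon$ such that for any $\varepsilon\in(0,\varepsilon_0]$ the lifespan satisfies $$T(\varepsilon)\leqslant c_2\,\Phi^{-1}\left(C_2\,\varepsilon^{-(p-1)}\right),$$ where $\Phi(t)=\int_0^t\varphi(s)\,\mathrm{d}s$ for $t\geqslant0$.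
   Context: Functions are real-valued. $\mathbb{G}$ carries its normalized Haar measure $\mathrm{d}x$ (total mass $1$), and $L^q(\mathbb{G})$ is taken with respect to it. $\mathcal{L}$ is the Laplace-Beltrami operator of $\mathbb{G}$ (for a bi-invariant Riemannian metric), with the sign convention that $-\mathcal{L}$ is nonnegative. The Sobolev space is $H^1_{\mathcal{L}}(\mathbb{G})=\{f\in L^2(\mathbb{G}): (-\mathcal{L})^{1/2}f\in L^2(\mathbb{G})\}$ with norm $\|f\|_{L^2(\mathbb{G})}+\|(-\mathcal{L})^{1/2}f\|_{L^2(\mathbb{G})}$. Uniform upper scaling condition: a function $\varphi:[0,+\infty)\to[0,+\infty)$ satisfies it if there exist $K>0$, $\lambda_0\in(0,1)$ and $a\geqslant0$ such that $\varphi(s)\geqslant K\varphi(\lambda s)$ for any $\lambda\in(\lambda_0,1]$ and any $s\geqslant a$. Energy solutions: $u\in\mathcal{C}([0,T),H^1_{\mathcal{L}}(\mathbb{G}))\cap\mathcal{C}^1([0,T),L^2(\mathbb{G}))$ with $\varphi|u|^p\in L^1_{\mathrm{loc}}([0,T)\times\mathbb{G})$ is an energy solution of $(\ast)$ on $[0,T)$ if for every $\psi\in\mathcal{C}^\infty_0([0,T)\times\mathbb{G})$ and every $t\in(0,T)$ $$\begin{aligned}&\int_{\mathbb{G}}\partial_t u(t,x)\psi(t,x)\,\mathrm{d}x-\int_{\mathbb{G}}u(t,x)\psi_s(t,x)\,\mathrm{d}x+\int_{\mathbb{G}}u(t,x)\psi(t,x)\,\mathrm{d}x\\&\quad-\varepsilon\int_{\mathbb{G}}u_1(x)\psi(0,x)\,\mathrm{d}x+\varepsilon\int_{\mathbb{G}}u_0(x)\psi_s(0,x)\,\mathrm{d}x-\varepsilon\int_{\mathbb{G}}u_0(x)\psi(0,x)\,\mathrm{d}x\\&\quad+\int_0^t\int_{\mathbb{G}}u(s,x)\big(\psi_{ss}(s,x)-\mathcal{L}\psi(s,x)-\psi_s(s,x)\big)\,\mathrm{d}x\,\mathrm{d}s=\int_0^t\int_{\mathbb{G}}\varphi(s)|u(s,x)|^p\psi(s,x)\,\mathrm{d}x\,\mathrm{d}s,\end{aligned}$$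 where $\psi_s$, $\psi_{ss}$ are derivatives in the time variable. The lifespan of $u$ is $T(\varepsilon)=\sup\{T>0: u\text{ is an energy solution of }(\ast)\text{ on }[0,T)\}$. If $\varphi$ is positive (and not in $L^1([0,+\infty))$), then $\Phi:[0,+\infty)\to[0,+\infty)$ is a strictly increasing bijection and $\Phi^{-1}$ denotes its inverse. *)

(* Defs.v *)
From HB Require Import structures.
From mathcomp Require Import all_boot all_order all_algebra.
From mathcomp Require Import all_classical all_reals all_analysis.
Set Implicit Arguments.
Unset Strict Implicit.
Unset Printing Implicit Defensive.
Import Order.TTheory GRing.Theory Num.Theory.
Import numFieldNormedType.Exports.
Local Open Scope classical_set_scope.
Local Open Scope ring_scope.

(* A multiplicative group with a topology. No compatibility is required here:
   it is part of [lie_structure]. *)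
#[short(type="topGroupType")]
HB.structure Definition TopGroup :=
  {G of PointedTopological G & Group G}.

(* Smoothness of [f] on an open subset [U] of a finite-dimensional space [V]:
   all iterated directional derivatives exist and are continuous on [U]. *)
Fixpoint Ck_on (R : realType) (V : normedModType R) (k : nat) :
    forall (W : normedModType R) (U : set V) (f : V -> W), Prop :=
  fun W U f =>
  (forall x, U x -> {for x, continuous f}) /\
  (if k is k'.+1 then
     forall v : V, (forall x, U x -> derivable f x v) /\
                   Ck_on k' U (fun x => 'D_v f x)
   else True).

Definition smooth_on (R : realType) (V W : normedModType R) (U : set V)
  (f : V -> W) : Prop := forall k : nat, Ck_on k U f.

Section LieGroups.
Context (R : realType).

Record chart (G : Type) (n : nat) := Chart {
  chart_dom : set G ;
  chart_map : G -> 'rV[R]_n ;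
  chart_inv : 'rV[R]_n -> G
}.

Definition chart_cod (G : Type) n (a : chart G n) : set 'rV[R]_n :=
  chart_map a @` chart_dom a.

Record is_chart (G : topologicalType) n (a : chart G n) : Prop := IsChart {
  chart_dom_open : open (chart_dom a) ;
  chart_cod_open : open (chart_cod a) ;
  chart_mapK : forall x, chart_dom a x -> chart_inv a (chart_map a x) = x ;
  chart_map_continuous :
    forall x, chart_dom a x -> {for x, continuous (chart_map a)} ;
  chart_inv_continuous :
    forall y, chart_cod a y -> {for y, continuous (chart_inv a)}
}.

(* Expression of [f : G -> G] in the charts [a] (source) and [b] (target). *)
Definition local_dom (G : Type) n (a b : chart G n) (f : G -> G) :
    set 'rV[R]_n :=
  chart_cod a `&` [set y | chart_dom b (f (chart_inv a y))].

Definition local_expr (G : Type) n (a b : chart G n) (f : G -> G) :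
    'rV[R]_n -> 'rV[R]_n :=
  fun y => chart_map b (f (chart_inv a y)).

Definition smooth_self_map (G : Type) n (A : set (chart G n)) (f : G -> G) :=
  forall a b, A a -> A b -> smooth_on (local_dom a b f) (local_expr a b f).

Record lie_structure (G : topGroupType) (n : nat) := LieStructure {
  atlas : set (chart G n) ;
  chart_at : G -> chart G n ;
  lie_hausdorff : hausdorff_space G ;
  lie_second_countable : @second_countable G ;
  atlas_chart : forall a, atlas a -> is_chart a ;
  chart_at_atlas : forall x, atlas (chart_at x) ;
  chart_at_dom : forall x, chart_dom (chart_at x) x ;
  (* the transition maps are smooth *)
  atlas_compatible : smooth_self_map atlas id ;
  lie_mul_continuous : continuous (fun z : G * G => (z.1 * z.2)%g) ;
  lie_inv_continuous : continuous (fun x : G => (x^-1)%g) ;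
  lie_mul_smooth : forall a b c, atlas a -> atlas b -> atlas c ->
    smooth_on
      [set z : 'rV[R]_n * 'rV[R]_n | [/\ chart_cod a z.1, chart_cod b z.2 &
         chart_dom c (chart_inv a z.1 * chart_inv b z.2)%g]]
      (fun z => chart_map c (chart_inv a z.1 * chart_inv b z.2)%g) ;
  lie_inv_smooth : smooth_self_map atlas (fun x => (x^-1)%g)
}.

Section Laplacian.
Context (G : topGroupType) (n : nat) (S : lie_structure G n).

Definition smooth (f : G -> R) : Prop :=
  forall a, atlas S a -> smooth_on (chart_cod a) (fun y => f (chart_inv a y)).

(* A metric is given by its Gram matrices in the coordinates of each chart.
   ['J] acts on row vectors on the right ('D_v f y = v *m 'J f y), so the
   pullback of the form v1 *m B *m v2^T is J *m B *m J^T. *)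
Definition isometric (g : chart G n -> 'rV[R]_n -> 'M[R]_n) (f : G -> G) :=
  forall a b, atlas S a -> atlas S b -> forall y, local_dom a b f y ->
    let J := 'J (local_expr a b f) y in
    g a y = J *m g b (local_expr a b f y) *m J^T.

Record riemannian_metric (g : chart G n -> 'rV[R]_n -> 'M[R]_n) : Prop := {
  metric_smooth : forall a, atlas S a -> smooth_on (chart_cod a) (g a) ;
  metric_sym : forall a y, atlas S a -> chart_cod a y -> (g a y)^T = g a y ;
  metric_pos : forall a y, atlas S a -> chart_cod a y ->
    forall v : 'rV[R]_n, v != 0 -> 0 < (v *m g a y *m v^T) 0 0 ;
  (* independence of the chart *)
  metric_compatible : isometric g id
}.

Definition bi_invariant (g : chart G n -> 'rV[R]_n -> 'M[R]_n) : Prop :=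
  forall h : G, isometric g (fun x => (h * x)%g) /\
                isometric g (fun x => (x * h)%g).

Context (g : chart G n -> 'rV[R]_n -> 'M[R]_n).

(* |g|^(-1/2) d_i (|g|^(1/2) g^(ij) d_j f) in the coordinates of [a]. *)
Definition local_laplace (a : chart G n) (f : 'rV[R]_n -> R) (y : 'rV[R]_n) :
    R :=
  let e i : 'rV[R]_n := delta_mx 0 i in
  let vol z := Num.sqrt (\det (g a z)) in
  (vol y)^-1 * \sum_(i < n)
    'D_(e i) (fun z => vol z *
                \sum_(j < n) invmx (g a z) i j * 'D_(e j) f z) y.

(* For smooth [f] the value does not depend on the chart around [x]. *)
Definition laplace (f : G -> R) (x : G) : R :=
  let a := chart_at S x in
  local_laplace a (fun y => f (chart_inv a y)) (chart_map a x).

Definition laplace_eigenfunction (lambda : R) (e : G -> R) : Prop :=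
  smooth e /\ forall x, - laplace e x = lambda * e x.

End Laplacian.

Definition borel (G : topGroupType) := g_sigma_algebraType (@open G).

Definition haar (G : topGroupType) (mu : probability (borel G) R) : Prop :=
  forall (h : G) (A : set (borel G)), measurable A ->
    mu [set (h * x)%g | x in (A : set G)] = mu A.

Section Sobolev.
Context (G : topGroupType) (n : nat) (S : lie_structure G n)
  (g : chart G n -> 'rV[R]_n -> 'M[R]_n) (mu : probability (borel G) R).

Definition L2 (f : G -> R) : Prop := (f : borel G -> R) \in Lfun mu 2%:E.

Definition L2norm (f : G -> R) : \bar R :=
  Lnorm mu 2%:E (EFin \o (f : borel G -> R)).

(* [h] is (-L)^(1/2) f as an element of L^2. -L has discrete spectrum, with
   smooth eigenfunctions spanning a dense subspace of L^2, and its square root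
   multiplies by lambda^(1/2) the components along the lambda-eigenspace. *)
Definition is_sqrt_laplace (f h : G -> R) : Prop :=
  L2 h /\ forall lambda e, laplace_eigenfunction S g lambda e ->
    \int[mu]_x (h x * e x) = Num.sqrt lambda * \int[mu]_x (f x * e x).

Definition H1 (f : G -> R) : Prop :=
  L2 f /\ exists h, is_sqrt_laplace f h.

Definition sqrt_laplace (f : G -> R) : G -> R :=
  xget (fun=> 0) [set h | is_sqrt_laplace f h].

Definition H1norm (f : G -> R) : \bar R :=
  (L2norm f + L2norm (sqrt_laplace f))%E.

(* Elements of L^2 and H^1 are represented by functions, so the distance
   between two of them is a seminorm [N] of the difference. *)
Definition continuous_curve (N : (G -> R) -> \bar R) (T : R) (u : R -> G -> R) :=
  forall t, 0 <= t < T ->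
    N (fun x => u s x - u t x) @[s --> within [set s | 0 <= s < T] (nbhs t)]
      --> 0%E.

(* [ut] is the derivative of [u : [0, T) -> L^2]; it is one-sided at 0. *)
Definition L2_derivative (T : R) (u ut : R -> G -> R) :=
  forall t, 0 <= t < T ->
    L2norm (fun x => h^-1 * (u (t + h) x - u t x) - ut t x)
      @[h --> within [set h | 0 <= t + h < T] (0 : R)^'] --> 0%E.

End Sobolev.

Section EnergySolutions.
Context (G : topGroupType) (n : nat) (S : lie_structure G n)
  (g : chart G n -> 'rV[R]_n -> 'M[R]_n) (mu : probability (borel G) R).

(* C_0^oo([0, T) x G): smoothness up to t = 0 means that [psi] is the
   restriction of a smooth function on R x G. *)
Record test_function (T : R) (psi : R -> G -> R) : Prop := TestFunction {
  test_smooth : forall a, atlas S a ->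
    smooth_on [set z : R^o * 'rV[R]_n | chart_cod a z.2]
              (fun z => psi z.1 (chart_inv a z.2) : R^o) ;
  (* [G] is compact, so only the time support matters *)
  test_compact_support :
    exists2 T', T' < T & forall t x, T' <= t -> psi t x = 0
}.

Definition dt (k : nat) (psi : R -> G -> R) : R -> G -> R :=
  fun t x => derive1n k (fun s => psi s x) t.

Definition weak_identity (p : R) (phi : R -> R) (eps : R) (u0 u1 : G -> R)
    (u ut : R -> G -> R) (psi : R -> G -> R) (t : R) : Prop :=
  \int[mu]_x (ut t x * psi t x) - \int[mu]_x (u t x * dt 1 psi t x)
  + \int[mu]_x (u t x * psi t x)
  - eps * \int[mu]_x (u1 x * psi 0 x)
  + eps * \int[mu]_x (u0 x * dt 1 psi 0 x)
  - eps * \int[mu]_x (u0 x * psi 0 x)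
  + \int[lebesgue_measure]_(s in `[0, t])
      \int[mu]_x (u s x *
        (dt 2 psi s x - laplace S g (psi s) x - dt 1 psi s x))
  = \int[lebesgue_measure]_(s in `[0, t])
      \int[mu]_x (phi s * `|u s x| `^ p * psi s x).

(* Only the values of [u] on [0, T) are relevant. *)
Definition energy_solution (p : R) (phi : R -> R) (eps : R) (u0 u1 : G -> R)
    (u : R -> G -> R) (T : R) : Prop :=
  (forall t, 0 <= t < T -> H1 S g mu (u t)) /\
  continuous_curve (H1norm S g mu) T u /\
  (* phi |u|^p is in L^1_loc([0, T) x G); recall that [G] is compact *)
  (forall b, 0 <= b < T ->
    (lebesgue_measure \x mu)%E.-integrable (`[0, b] `*` setT)
      (fun z : R * borel G => (phi z.1 * `|u z.1 z.2| `^ p)%:E)) /\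
  exists ut : R -> G -> R,
    [/\ forall t, 0 <= t < T -> L2 mu (ut t),
        continuous_curve (L2norm mu) T ut,
        L2_derivative mu T u ut &
        forall psi, test_function T psi -> forall t, 0 < t < T ->
          weak_identity p phi eps u0 u1 u ut psi t].

Definition lifespan (p : R) (phi : R -> R) (eps : R) (u0 u1 : G -> R)
    (u : R -> G -> R) : \bar R :=
  ereal_sup [set T%:E | T in
    [set T : R | 0 < T /\ energy_solution p phi eps u0 u1 u T]].

End EnergySolutions.

Definition L1loc_halfline (phi : R -> R) : Prop :=
  forall b : R, lebesgue_measure.-integrable `[0, b] (EFin \o phi).

Definition upper_scaling (phi : R -> R) : Prop :=
  exists K lambda0 a : R, [/\ 0 < K, 0 < lambda0 < 1, 0 <= a &
    forall lambda s, lambda0 < lambda <= 1 -> a <= s ->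
      phi s >= K * phi (lambda * s)].

Definition primitive (phi : R -> R) (t : R) : R :=
  \int[lebesgue_measure]_(s in `[0, t]) phi s.

(* Inverse of the primitive on [0, +oo). *)
Definition primitive_inv (phi : R -> R) : R -> R :=
  'pinv_(fun=> 0) `[0, +oo[ (primitive phi).

End LieGroups.

(* Main.v *)
Require Import Defs.
From mathcomp Require Import all_boot all_order all_algebra.
From mathcomp Require Import all_classical all_reals all_analysis.
From mathcomp Require Import measurable_realfun ring lra.
Import Order.TTheory GRing.Theory Num.Theory.
Import numFieldNormedType.Exports.
Local Open Scope classical_set_scope.
Local Open Scope ring_scope.

(** Write U t for the mean of u(t) over the group.  Testing the equation with
    a function of time alone removes the Laplacian, and testing it with
    s |-> 1 - e^(s - t) (cut off after time t) also removes the time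
    derivative of u at time t and the linear term inside the integral, since
    this function vanishes at s = t and solves psi'' = psi'.  What is left is
    the Duhamel formula of the ODE U'' + U' = F
    ([duhamel_formula]):
      U t = eps I0 + eps I1 (1 - e^(-t)) + int_0^t (1 - e^(s - t)) F s ds,
    where I0 and I1 are the means of the data and F s is the mean of
    phi(s) |u(s)|^p, which is at least phi(s) (U s)^p by Hoelder.
    Everything on the right grows with t, so U is nondecreasing and at least
    eps I0, and for r <= m <= t ([mean_growth])
      U t >= U r + (1 - e^(m - t)) (U r)^p (Phi m - Phi r).

    This is the growth of U' = phi U^p, except that the mass of phi collected
    up to time m acts only at a later time t.  Doubling U as for the ODE needs
    masses Phi x_(k+1) - Phi x_k whose sum is of order (eps I0)^(-(p-1)), and
    delays that also shrink geometrically.  To make room for the delays, the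
    k-th doubling is performed at the time L_k x_k with 1 <= L_k < Lam
    increasing in k; the scaling condition implies that stretching an interval
    by such a factor leaves it at least the fraction K of its phi-mass
    ([primitive_scaling]).  Then U (L_k x_k) >= 2^k eps I0 with
    L_k x_k <= Lam tau, where tau is any time at which Phi has gained a fixed
    multiple of (eps I0)^(-(p-1)); hence the solution cannot live beyond
    Lam tau ([delayed_growth_lifespan]).

    As phi is not integrable, Phi is unbounded and such a tau exists, which is
    the blow-up.  For small eps one can take
    tau = Phi^(-1) (C2 eps^(-(p-1))), which is the lifespan estimate. *)

(** * Cut-off functions of time *)

(** x^(-n) exp(-1/x) continued by 0 to x <= 0.  The negative powers are included
    because differentiating exp(-1/x) creates them. *)
Definition flat {R : realType} (n : nat) (x : R) : R :=
  if 0 < x then x^-1 ^+ n * expR (- x^-1) else 0.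

(** A family of functions stable under differentiation, so that one induction
    on the construction gives all derivatives at once; it is large enough to
    contain a cut-off function and the exponential test function. *)
Inductive elementary {R : realType} : (R -> R) -> Prop :=
| elementary_cst c : elementary (fun=> c)
| elementary_id : elementary id
| elementary_exp : elementary expR
| elementary_flat n : elementary (flat n)
| elementary_add f h : elementary f -> elementary h ->
    elementary (fun x => f x + h x)
| elementary_mul f h : elementary f -> elementary h ->
    elementary (fun x => f x * h x)
| elementary_comp f h : elementary f -> elementary h ->
    elementary (fun x => f (h x)).

Lemma flat_ge0 (R : realType) n (x : R) : 0 <= flat n x.
Proof.
rewrite /flat; case: ifPn => // x0.
by rewrite mulr_ge0 ?expR_ge0// exprn_ge0// invr_ge0 ltW.
Qed.

(** One term of the exponential series bounds exp(-1/x) by a multiple of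
    x^(n+2).  The quadratic bound makes [flat n] differentiable at 0 with
    derivative 0. *)
Lemma flat_le_sqr (R : realType) n (x : R) :
  flat n x <= (n.+2)`!%:R * x ^+ 2.
Proof.
rewrite /flat; case: ifPn => [x0|_]; last by rewrite mulr_ge0 ?sqr_ge0.
have y0 : 0 <= x^-1 by rewrite invr_ge0 ltW.
have := expR_ge1Dxn n.+1 y0.
set N : R := (n.+2)`!%:R => H.
have N0 : 0 < N by rewrite ltr0n fact_gt0.
have {H} : x^-1 ^+ n.+2 / N <= expR x^-1.
  by apply: le_trans H; rewrite lerDr.
rewrite ler_pdivrMr// expRN => H.
rewrite ler_pdivrMr ?expR_gt0//.
rewrite (_ : x^-1 ^+ n = x ^+ 2 * x^-1 ^+ n.+2); last first.
  by rewrite -(addn2 n) exprD mulrCA -exprMn divff ?gt_eqF// expr1n mulr1.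
rewrite (_ : N * _ * _ = x ^+ 2 * (expR x^-1 * N)); last by ring.
by rewrite ler_pM2l// exprn_gt0.
Qed.

Lemma is_derive_flat (R : realType) n (x : R) :
  is_derive x 1 (@flat R n) (flat n.+2 x - n%:R * flat n.+1 x).
Proof.
have [x0|x0|->] := ltgtP x 0.
- rewrite /flat !ltNge !(ltW x0)/= mulr0 subr0.
  apply: (@near_eq_is_derive _ _ _ (cst 0)) => //.
  near=> y; rewrite ltNge (_ : y <= 0)//; apply/ltW.
  by near: y; exact: lt_nbhsl.
- rewrite /flat x0; pose q (y : R) := y ^+ n * expR (- y).
  apply: (@near_eq_is_derive _ _ _ (q \o GRing.inv)).
    near=> y; rewrite (_ : 0 < y)//.
    by near: y; exact: lt_nbhsr.
  have H : is_derive x (1:R) GRing.inv (- x ^- 2).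
    apply: is_derive_eq; first by apply: is_deriveV; rewrite ?gt_eqF.
    by rewrite /GRing.scale/= mulr1.
  have He y : is_derive y (1:R) (fun y => expR (- y)) (expR (- y) * -1).
    exact: (is_derive1_comp (is_derive_expR (- y)) (is_deriveNid y 1)).
  have Hn y : is_derive y (1:R) (fun y => y ^+ n) (n%:R * y ^+ n.-1).
    have -> : (fun y : R => y ^+ n) = id ^+ n.
      by apply/funext => z; rewrite exprfctE.
    apply: is_derive_eq.
    by rewrite /GRing.scale/= mulr1 mulr_natl.
  have Hq : is_derive x^-1 (1:R) q _ :=
    is_deriveM (Hn x^-1) (He x^-1).
  apply: is_derive_eq.
  rewrite -exprVn; set y := x^-1; move: {Hq He Hn H q}y => y.
  rewrite /GRing.scale/=; case: n => [|n]; rewrite ?exprS ?expr0 /=; ring.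
- rewrite /flat !ltxx/= mulr0 subr0.
  have H : (fun h : R => h^-1 *: ((flat n \o shift 0) (h *: 1) - flat n 0))
      @ 0^' --> (0 : R).
    apply/cvgr0Pnorm_le => e e0.
    set N : R := (n.+2)`!%:R.
    have N0 : 0 < N by rewrite ltr0n fact_gt0.
    near=> h.
    have hn0 : h != 0 by near: h; exact: nbhs_dnbhs_neq.
    rewrite /GRing.scale/= mulr1 addr0 {2}/flat ltxx subr0 normrM normfV.
    rewrite ler_pdivrMl ?normr_gt0// (ger0_norm (flat_ge0 _ _ _)).
    apply: le_trans (flat_le_sqr _ _ _) _.
    rewrite -real_normK ?num_real// expr2 mulrCA ler_pM2l ?normr_gt0//.
    rewrite -ler_pdivlMl// ltW//.
    near: h; apply: dnbhs0_lt.
    by rewrite mulr_gt0// invr_gt0.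
  apply: DeriveDef; first by apply/cvg_ex; exists 0; exact: H.
  by apply: cvg_lim => //; exact: H.
Unshelve. all: by end_near. Qed.

Lemma elementary_derive {R : realType} {f : R -> R} : elementary f ->
  exists2 f', elementary f' & forall x : R, is_derive x (1 : R) f (f' x).
Proof.
elim=> [c|||n|{}f h ef [f' ef' df] eh [h' eh' dh]
  |{}f h ef [f' ef' df] eh [h' eh' dh]|{}f h ef [f' ef' df] eh [h' eh' dh]].
- by exists (fun=> 0); [exact: elementary_cst|move=> x; exact: is_derive_cst].
- by exists (fun=> 1); [exact: elementary_cst|move=> x; exact: is_derive_id].
- by exists expR; [exact: elementary_exp|move=> x; exact: is_derive_expR].
- exists (fun x => flat n.+2 x + (- n%:R) * flat n.+1 x).
    apply: elementary_add; [|apply: elementary_mul];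
      by [exact: elementary_flat|exact: elementary_cst].
  by move=> x; rewrite mulNr; exact: is_derive_flat.
- exists (fun x => f' x + h' x); first exact: elementary_add.
  by move=> x; exact: is_deriveD.
- exists (fun x => f x * h' x + h x * f' x).
    by apply: elementary_add; exact: elementary_mul.
  by move=> x; exact: is_deriveM.
- exists (fun x => f' (h x) * h' x).
    by apply: elementary_mul => //; exact: elementary_comp.
  by move=> x; exact: is_derive1_comp.
Qed.

Lemma elementary_continuous {R : realType} {f : R -> R} :
  elementary f -> continuous f.
Proof.
move=> /elementary_derive[f' _ df] x.
by apply/differentiable_continuous/derivable1_diffP; case: (df x).
Qed.

Lemma is_derive_direction {R : realType} (f : R -> R) (x v l : R) :
  is_derive x (1 : R) f l -> is_derive x v f (v * l).
Proof.
move=> [/derivable1_diffP dfx <-].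
apply: DeriveDef; first exact: diff_derivable.
by rewrite !deriveE// -[v in LHS]mulr1 linearZ.
Qed.

(** A function of the first coordinate has directional derivatives
    v.1 * f', and these are again elementary functions of that coordinate. *)
Lemma elementary_Ck {R : realType} (V : normedModType R) k
  (U : set (R^o * V)) (f : R -> R) : elementary f ->
  Ck_on k U (fun z => f z.1 : R^o).
Proof.
elim: k f => [|k IH] f ef; (split; first by
  move=> x _; apply: continuous_comp;
    [exact: cvg_fst|exact: elementary_continuous]) => //.
have [f' ef' df] := elementary_derive ef.
have dv (v : R^o * V) z :
    is_derive z v (fun z : R^o * V => f z.1 : R^o) (v.1 * f' z.1).
  have df1 : is_derive (z.1 : R^o) v.1 (f : R^o -> R^o) (v.1 * f' z.1).
    exact: (@is_derive_direction _ f _ _ _ (df z.1)).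
  by case: df1 => ? ?; apply: DeriveDef.
move=> v; split=> [x _|]; first by case: (dv v x).
rewrite (_ : (fun x => _) = (fun z => v.1 * f' z.1 : R^o)).
  apply: (IH (fun s => v.1 * f' s)).
  by apply: elementary_mul => //; exact: elementary_cst.
by apply/funext => z; apply: derive_val.
Qed.

(** With e x = exp(-1/x), the function e (e 1 - e x) is constant for x <= 0,
    where the inner flat function vanishes, and is 0 for x >= 1, where the
    argument of the outer one is nonpositive; it remains to rescale. *)
Lemma elementary_cutoff {R : realType} (a b : R) : a < b ->
  exists2 chi, elementary chi &
    (forall s, s <= a -> chi s = 1) /\ (forall s, b <= s -> chi s = 0).
Proof.
move=> ab; have ba0 : 0 < b - a by rewrite subr_gt0.
have f1 : 0 < flat 0 (1 : R) by rewrite /flat ltr01 mul1r expR_gt0.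
pose c : R := flat 0 (flat 0 1).
have c0 : c != 0 by rewrite /c {1}/flat f1 expr0 mul1r gt_eqF// expR_gt0.
exists (fun s => c^-1 *
    flat 0 (flat 0 1 + (-1) * flat 0 ((b - a)^-1 * (s + - a)))).
  apply: elementary_mul; first exact: elementary_cst.
  apply: (elementary_comp (flat 0)); first exact: elementary_flat.
  apply: elementary_add; first exact: elementary_cst.
  apply: elementary_mul; first exact: elementary_cst.
  apply: (elementary_comp (flat 0)); first exact: elementary_flat.
  apply: elementary_mul; first exact: elementary_cst.
  by apply: elementary_add; [exact: elementary_id|exact: elementary_cst].
split=> s sab.
  rewrite [X in -1 * X](_ : _ = 0) ?mulr0 ?addr0 ?mulVf//.
  rewrite /flat ltNge pmulr_rle0 ?invr_gt0// (_ : s + - a <= 0)//.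
  by rewrite subr_le0.
rewrite [X in c^-1 * X](_ : _ = 0) ?mulr0// {1}/flat ltNge mulN1r subr_le0.
have y1 : 1 <= (b - a)^-1 * (s + - a).
  by rewrite mulrC ler_pdivlMr// mul1r lerD2r.
rewrite /flat ltr01 (lt_le_trans ltr01 y1) !expr0 !mul1r ler_expR lerN2.
by rewrite lef_pV2 ?posrE ?y1//; exact: lt_le_trans ltr01 y1.
Qed.

Lemma test_function_time {R : realType} {G : topGroupType} {n : nat}
    (S : lie_structure R G n) (T T' : R) (h : R -> R) :
  elementary h -> T' < T -> (forall t, T' <= t -> h t = 0) ->
  test_function S T (fun t _ => h t).
Proof.
move=> eh TT h0; split; last by exists T' => // t x; exact: h0.
by move=> a _ k; exact: elementary_Ck.
Qed.

Lemma laplace_cst {R : realType} {G : topGroupType} {n : nat}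
    (S : lie_structure R G n) g (c : R) x : laplace S g (fun=> c) x = 0.
Proof.
rewrite /laplace /local_laplace big1 ?mulr0// => i _.
rewrite (_ : (fun _ => _ ) = cst 0) ?derive_cst//.
apply/funext => z; rewrite big1 ?mulr0//= => j _.
by rewrite derive_cst mulr0.
Qed.

(** * The primitive of the time weight *)

Lemma measurable_dilation {R : realType} (L : R) :
  measurable_fun setT (fun x : measurableTypeR R => L * x : measurableTypeR R).
Proof. exact: mulrl_measurable. Qed.

(** Both sides are measures that agree on half-open intervals. *)
Lemma lebesgue_measure_dilation {R : realType} (L : R) (L0 : 0 < L)
    (A : set R) : measurable A ->
  lebesgue_measure A =
  (L%:E * pushforward lebesgue_measure
    (fun x : measurableTypeR R => (L * x)%R : measurableTypeR R) A)%E.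
Proof.
pose m : {measure set (measurableTypeR R) -> \bar R} :=
  mscale (NngNum (ltW L0)) (pushforward lebesgue_measure
    (fun x : measurableTypeR R => (L * x)%R : measurableTypeR R)).
move=> mA; rewrite -[RHS]/(m (measurable_dilation L) A).
apply: lebesgue_measure_unique => // _ [[a b]] _ <-.
rewrite /m/= /mscale/= /pushforward/=.
rewrite (_ : _ @^-1` _ = `](a / L), (b / L)]%classic); last first.
  apply/seteqP; split=> x/=; rewrite !in_itv/=;
    by rewrite ltr_pdivrMr// ler_pdivlMr// (mulrC x).
rewrite !lebesgue_measure_itv/= !lte_fin ltr_pM2r ?invr_gt0//.
case: ifPn => _; last by rewrite mule0.
by rewrite -!EFinB -EFinM -mulrBl mulrC divfK ?gt_eqF.
Qed.

Lemma ge0_integral_dilation {R : realType} (L a b : R) (f : R -> \bar R) :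
  0 < L -> measurable_fun `]L * a, L * b] f ->
  (forall x, x \in `]L * a, L * b] -> (0 <= f x)%E) ->
  (\int[lebesgue_measure]_(x in `](L * a)%R, (L * b)%R]) f x =
   L%:E * \int[lebesgue_measure]_(x in `]a, b]) f (L * x)%R)%E.
Proof.
move=> L0 mf f0; have mdil := measurable_dilation L.
pose m : {measure set (measurableTypeR R) -> \bar R} :=
  mscale (NngNum (ltW L0)) (pushforward lebesgue_measure
    (fun x : measurableTypeR R => (L * x)%R : measurableTypeR R)).
rewrite (eq_measure_integral (m mdil)); last first.
  by move=> A mA _; exact: lebesgue_measure_dilation.
rewrite ge0_integral_mscale//; congr (_ * _)%E.
rewrite ge0_integral_pushforward//; last by move=> x /[!inE]; exact: f0.
congr (integral _ _ _).
apply/seteqP; split=> x/=; rewrite !in_itv/=;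
  by rewrite ltr_pM2l// ler_pM2l.
Qed.

Lemma primitiveB {R : realType} (phi : R -> R)
    (phi_loc : L1loc_halfline phi) r s : 0 <= r -> r <= s ->
  primitive phi s - primitive phi r =
    \int[lebesgue_measure]_(x in `]r, s]) phi x.
Proof. by move=> r0 rs; rewrite /primitive Rintegral_itvB ?bnd_simp. Qed.

Lemma primitive0 {R : realType} (phi : R -> R) : primitive phi 0 = 0.
Proof. by rewrite /primitive set_itv1 Rintegral_set1. Qed.

Lemma primitive_nondecreasing {R : realType} (phi : R -> R)
    (phi_ge0 : forall s, 0 <= s -> 0 <= phi s)
    (phi_loc : L1loc_halfline phi) r s : 0 <= r -> r <= s ->
  primitive phi r <= primitive phi s.
Proof.
move=> r0 rs; rewrite -subr_ge0 primitiveB// Rintegral_ge0// => x/=.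
by rewrite in_itv/= => /andP[rx _]; rewrite phi_ge0// (le_trans r0)// ltW.
Qed.

Lemma primitive_ge0 {R : realType} (phi : R -> R)
    (phi_ge0 : forall s, 0 <= s -> 0 <= phi s)
    (phi_loc : L1loc_halfline phi) r : 0 <= r -> 0 <= primitive phi r.
Proof. by move=> r0; rewrite -(primitive0 phi) primitive_nondecreasing. Qed.

Lemma primitive_continuous {R : realType} (phi : R -> R)
    (phi_loc : L1loc_halfline phi) a b : 0 <= a ->
  {within `[a, b], continuous (primitive phi)}.
Proof.
move=> a0; have [ab|ba] := leP a b; last first.
  by rewrite set_itv_ge ?bnd_simp -?ltNge//; exact: continuous_subspace0.
apply: (@continuous_subspaceW _ _ _ `[0, b]).
  by apply: subset_itvr; rewrite bnd_simp.
exact: parameterized_integral_continuous (le_trans a0 ab) (phi_loc b).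
Qed.

(** On the stretched interval, phi (L x) >= K phi x by the scaling condition
    with lambda = 1 / L; the Jacobian L >= 1 of the dilation only helps. *)
Lemma primitive_scaling {R : realType} (phi : R -> R)
    (phi_ge0 : forall s, 0 <= s -> 0 <= phi s)
    (phi_loc : L1loc_halfline phi) (K lambda0 a L r s : R) :
  0 < K -> 0 <= a -> 1 <= L -> L < lambda0^-1 -> 0 < lambda0 ->
  (forall lambda s, lambda0 < lambda <= 1 -> a <= s ->
    phi s >= K * phi (lambda * s)) ->
  a <= r -> r <= s ->
  K * (primitive phi s - primitive phi r) <=
    primitive phi (L * s) - primitive phi (L * r).
Proof.
move=> K0 a0 L1 Ll l0 scal ar rs.
have L0 : 0 < L by exact: lt_le_trans L1.
have r0 : 0 <= r by exact: le_trans ar.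
have Lrs : L * r <= L * s by rewrite ler_pM2l.
have Lr0 : 0 <= L * r by rewrite mulr_ge0// ltW.
rewrite !(primitiveB _ phi_loc)//.
have irs : lebesgue_measure.-integrable `]r, s] (EFin \o phi).
  apply: integrableS (phi_loc s) => // x/=; rewrite !in_itv/= => /andP[rx ->].
  by rewrite (le_trans r0) ?ltW.
have iLrs : lebesgue_measure.-integrable `]L * r, L * s] (EFin \o phi).
  apply: integrableS (phi_loc (L * s)) => // x/=.
  rewrite !in_itv/= => /andP[rx ->].
  by rewrite (le_trans Lr0) ?ltW.
have mLrs := measurable_int _ iLrs.
have iK : lebesgue_measure.-integrable `]r, s] (fun x => (K * phi x)%:E).
  rewrite (_ : (fun _ => _) = (fun x => K%:E * (phi x)%:E)%E); last first.
    by apply/funext => x; rewrite EFinM.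
  exact: integrableZl.
rewrite -RintegralZl// /Rintegral fine_le//.
- exact: integrable_fin_num iK.
- exact: integrable_fin_num.
rewrite ge0_integral_dilation//; last first.
  by move=> x; rewrite in_itv/= => /andP[rx _];
    rewrite lee_fin phi_ge0// (le_trans Lr0)// ltW.
have phiL0 x : x \in `]r, s] -> 0 <= phi (L * x).
  rewrite in_itv/= => /andP[rx _].
  by rewrite phi_ge0// mulr_ge0 ?(ltW L0)// (le_trans r0)// ltW.
apply: le_trans (lee_pemull _ _); last 2 first.
- by apply: integral_ge0 => x xrs; rewrite lee_fin phiL0.
- by rewrite lee_fin.
apply: ge0_le_integral => //.
- move=> x; rewrite /= in_itv/= => /andP[rx _].
  by rewrite lee_fin mulr_ge0 ?(ltW K0)// phi_ge0// (le_trans r0)// ltW.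
- exact: measurable_int iK.
- apply: (@measurable_comp _ _ _ _ _ _ `]L * r, L * s]%classic (EFin \o phi)
      _ (fun x => L * x)) => //.
  + by move=> _ [x + <-]; rewrite /= !in_itv/= ltr_pM2l// ler_pM2l.
  + exact: measurable_funS (measurable_dilation L).
move=> x; rewrite /= in_itv/= => /andP[rx _]; rewrite lee_fin.
have x0 : 0 < x by exact: le_lt_trans rx.
have := scal L^-1 (L * x); rewrite mulrA mulVf ?gt_eqF// mul1r; apply.
  rewrite invf_le1// L1 andbT -[ltLHS]invrK ltf_pV2 ?posrE ?invr_gt0//.
by rewrite (le_trans ar)// (le_trans (ltW rx))// ler_peMl// ltW.
Qed.

(** A bound on the primitive would bound the integral over the half line, by
    monotone convergence. *)
Lemma primitive_unbounded {R : realType} (phi : R -> R)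
    (phi_ge0 : forall s, 0 <= s -> 0 <= phi s)
    (phi_loc : L1loc_halfline phi) :
  ~ lebesgue_measure.-integrable `[0, +oo[ (EFin \o phi) ->
  forall M, exists2 t, 0 <= t & M <= primitive phi t.
Proof.
move=> nint M; apply: contrapT => /forall2NP H; apply: nint.
have Hn n : primitive phi n%:R <= M.
  by have [//|/negP] := H n%:R; rewrite -ltNge => /ltW.
pose F n := `[0, n%:R]%classic : set R.
have FU : `[0, +oo[%classic = \bigcup_n F n.
  apply/seteqP; split=> [x|x [n _]]; rewrite /F/= !in_itv/=; last first.
    by case/andP => ->.
  rewrite andbT => x0; exists (Num.bound x) => //; rewrite /F/= in_itv/= x0/=.
  exact/ltW/archi_boundP.
have mF n : measurable (F n) by exact: measurable_itv.
have phiF n : measurable_fun (F n) (EFin \o phi).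
  exact: measurable_int (phi_loc n%:R).
have phi0 n x : F n x -> (0 <= (EFin \o phi) x)%E.
  by rewrite /F/= in_itv/= => /andP[x0 _]; rewrite lee_fin phi_ge0.
have ndF : nondecreasing_seq F.
  move=> m n mn; rewrite subsetEset; apply: subset_itvl.
  by rewrite bnd_simp ler_nat.
have cvgF : (\int[lebesgue_measure]_(x in F n) (EFin \o phi) x @[n --> \oo] -->
    \int[lebesgue_measure]_(x in \bigcup_i F i) (EFin \o phi) x)%E.
  exact: ge0_nondecreasing_set_cvg_integral.
rewrite FU; apply/integrableP; split; first exact/measurable_fun_bigcup.
apply: (@le_lt_trans _ _ M%:E); last by rewrite ltry.
rewrite [leLHS](_ : _ = \int[lebesgue_measure]_(x in \bigcup_i F i)
    (EFin \o phi) x)%E; last first.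
  apply: eq_integral => x; rewrite inE => -[n _ Fx].
  by rewrite gee0_abs// (phi0 n).
rewrite -(cvg_lim _ cvgF)//; apply: lime_le; first exact: cvgP cvgF.
apply: nearW => n.
rewrite -[X in (X <= _)%E]fineK ?lee_fin; first exact: Hn.
exact: integrable_fin_num (phi_loc n%:R).
Qed.

(** * Delayed growth forces blow-up *)

(** The common ratio q of the delays and of the phi-masses of the successive
    doublings.  It solves q^2 2^(p-1) = 1: each doubling multiplies U^(p-1) by
    2^(p-1), and this gain is shared equally between the two factors. *)
Definition step_ratio {R : realType} (p : R) : R := 2 `^ (- (p - 1) / 2).

(** The factor L_k by which the k-th time is stretched: it increases from 1 to
    Lam, with increments proportional to q^k. *)
Definition stretch {R : realType} (p Lam : R) (k : nat) : R :=
  Lam - (Lam - 1) * step_ratio p ^+ k.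

(** The gain of Phi, in units of A^(-(p-1)), that suffices to double a quantity
    starting from A infinitely often. *)
Definition threshold {R : realType} (p K Lam : R) : R :=
  let q := step_ratio p in let d := (Lam - 1) * (1 - q) in
  (1 + d) / (d * (1 - q) * K).

Lemma step_ratio_gt0 {R : realType} (p : R) : 0 < step_ratio p.
Proof. by rewrite powR_gt0. Qed.

Lemma step_ratio_lt1 {R : realType} (p : R) : 1 < p -> step_ratio p < 1.
Proof.
move=> p1; rewrite /step_ratio /powR pnatr_eq0 expR_lt1.
by rewrite mulNr mulNr oppr_lt0 mulr_gt0 ?ln_gt0 ?ltr1n// divr_gt0// subr_gt0.
Qed.

Lemma step_ratio_sqr {R : realType} (p : R) :
  step_ratio p ^+ 2 * 2 `^ (p - 1) = 1.
Proof.
rewrite -powR_mulrn ?powR_ge0// -powRrM divfK ?pnatr_eq0// powRN.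
by rewrite mulVf// gt_eqF// powR_gt0.
Qed.

Lemma threshold_gt0 {R : realType} (p K Lam : R) :
  1 < p -> 0 < K -> 1 < Lam -> 0 < threshold p K Lam.
Proof.
move=> p1 K0 L1; have q1 := step_ratio_lt1 p p1.
have d0 : 0 < (Lam - 1) * (1 - step_ratio p) by rewrite mulr_gt0 ?subr_gt0.
by rewrite divr_gt0 ?addr_gt0// !mulr_gt0 ?subr_gt0.
Qed.

(** Bounds the weight 1 - e^(-y) of a short delay y from below linearly. *)
Lemma onem_expRN_ge {R : realType} (y d : R) : 0 <= y <= d ->
  y / (1 + d) <= 1 - expR (- y).
Proof.
move=> /andP[y0 yd]; have y1 : 0 < 1 + y by rewrite ltr_wpDr.
have d1 : 0 < 1 + d by rewrite (lt_le_trans y1)// lerD2l.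
apply: (@le_trans _ _ (1 - (1 + y)^-1)).
  rewrite (_ : 1 - _ = y / (1 + y)); last by field; rewrite gt_eqF.
  by rewrite ler_wpM2l// lef_pV2 ?posrE// lerD2l.
by rewrite lerD2l lerN2 expRN lef_pV2 ?posrE ?expR_gt0// expR_ge1Dx.
Qed.

(** The four factors are the weight of the k-th delay, the power of the current
    lower bound 2^k A, the scaling constant, and the k-th phi-mass.  The
    constants cancel by the choice of the threshold and the powers of 2 by the
    choice of q, so the gain is exactly one more copy of 2^k A. *)
Lemma doubling_gain {R : realType} (p K Lam A : R) (k : nat) :
  1 < p -> 0 < K -> 1 < Lam -> 0 < A ->
  let q := step_ratio p in let d := (Lam - 1) * (1 - q) in
  d * q ^+ k / (1 + d) * (2 ^+ k * A) `^ p *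
    (K * (threshold p K Lam * A `^ (- (p - 1)) * (1 - q) * q ^+ k)) =
  2 ^+ k * A.
Proof.
move=> p1 K0 L1 A0 q d.
have q1 : 1 - q != 0 by rewrite gt_eqF// subr_gt0 step_ratio_lt1.
have d0 : 0 < d by rewrite mulr_gt0 ?subr_gt0 ?step_ratio_lt1.
have d1 : 1 + d != 0 by rewrite gt_eqF// addr_gt0.
have Kn : K != 0 by rewrite gt_eqF.
rewrite -{1}[p](subrK 1) powRD; last first.
  by apply/implyP => _; rewrite gt_eqF// mulr_gt0 ?exprn_gt0.
rewrite powRr1 ?mulr_ge0 ?exprn_ge0 ?ltW// powRM ?exprn_ge0 ?ltW//.
have -> : (2 ^+ k : R) `^ (p - 1) = (2 `^ (p - 1)) ^+ k.
  by rewrite -powR_mulrn// powRAC powR_mulrn ?powR_ge0.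
rewrite powRN.
have An : A `^ (p - 1) != 0 by rewrite gt_eqF// powR_gt0.
rewrite /threshold -/q -/d.
transitivity ((q ^+ 2 * 2 `^ (p - 1)) ^+ k * (2 ^+ k * A)); last first.
  by rewrite step_ratio_sqr expr1n mul1r.
rewrite exprMn -exprM mulnC exprM expr2; field.
by rewrite An d1 q1 Kn gt_eqF.
Qed.

(** If T exceeded Lam tau, then U would be at least 2^k A at the times
    L_k x_k <= Lam tau for all k, where Phi x_k = Phi a + eta (1 - q^k) and eta
    is the required gain of Phi.  One step goes from L_k x_k to
    L_(k+1) x_(k+1) through the intermediate time L_k x_(k+1): on the first
    part phi-mass is collected, and the second part is the delay, of length at
    least L_(k+1) - L_k as x_(k+1) >= a >= 1. *)
Lemma delayed_growth_lifespan {R : realType} (Phi U : R -> R)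
    (T p K Lam a A tau : R) :
  1 < p -> 0 < K -> 1 < Lam -> 1 <= a -> 0 < A -> a <= tau ->
  {within `[a, tau], continuous Phi} ->
  (forall r s, a <= r -> r <= s -> Phi r <= Phi s) ->
  (forall L r s, 1 <= L <= Lam -> a <= r -> r <= s ->
     K * (Phi s - Phi r) <= Phi (L * s) - Phi (L * r)) ->
  (forall r m t, 0 < r -> r <= m -> m <= t -> t < T ->
     U r + (1 - expR (m - t)) * U r `^ p * (Phi m - Phi r) <= U t) ->
  (forall t, 0 < t < T -> A <= U t) ->
  threshold p K Lam * A `^ (- (p - 1)) <= Phi tau - Phi a ->
  T <= Lam * tau.
Proof.
move=> p1 K0 L1 a1 A0 atau Phic Phind scal grow low thr.
rewrite leNgt; apply/negP => LT.
have a0 : 0 < a by exact: lt_le_trans a1.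
set q := step_ratio p; pose d := (Lam - 1) * (1 - q).
have q0 : 0 < q by exact: step_ratio_gt0.
have q1 : q < 1 by exact: step_ratio_lt1.
have Lam0 : 0 < Lam by exact: lt_trans L1.
have qk k : 0 < q ^+ k <= 1 by rewrite exprn_gt0//= exprn_ile1 ?ltW.
have L_bnd k : 1 <= stretch p Lam k <= Lam.
  have /andP[k0 k1] := qk k; rewrite /stretch -/q; apply/andP; split; last first.
    by rewrite gerBl mulr_ge0 ?subr_ge0 ?ltW.
  rewrite lerBrDl -lerBrDr -[leRHS]mulr1 ler_wpM2l// subr_ge0.
  exact: ltW.
pose eta := threshold p K Lam * A `^ (- (p - 1)).
have eta0 : 0 < eta by rewrite mulr_gt0 ?threshold_gt0 ?powR_gt0.
pose level k := Phi a + eta * (1 - q ^+ k).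
have levelE k : exists2 x, a <= x <= tau & Phi x = level k.
  have /andP[k0 k1] := qk k.
  have [|x] := @IVT _ Phi a tau (level k) atau Phic.
    rewrite min_l ?max_r ?Phind// lerDl mulr_ge0 ?subr_ge0 ?(ltW eta0)//=.
    rewrite -lerBrDl; apply: le_trans (_ : eta <= _); last exact: thr.
    by rewrite -[leRHS]mulr1 ler_wpM2l ?(ltW eta0)// gerBl ltW.
  by rewrite in_itv/= => xat <-; exists x.
have step k : exists2 x, (a <= x <= tau /\ Phi x = level k) &
    2 ^+ k * A <= U (stretch p Lam k * x).
  elim: k => [|k [x [/andP[ax xt] Phix] Ux]].
    exists a; first by rewrite lexx atau /level expr0 subrr mulr0 addr0.
    rewrite expr0 mul1r low// /stretch expr0 mulr1 subKr mul1r a0/=.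
    rewrite (le_lt_trans atau)// (le_lt_trans _ LT)// ler_peMl ?(ltW L1)//.
    exact: le_trans (ltW a0) atau.
  have [x' /andP[ax' x't] Phix'] := levelE k.+1.
  exists x'; first by rewrite ax' x't.
  have /andP[k0 k1] := qk k.
  have x0 : 0 < x by exact: lt_le_trans ax.
  have dPhi : Phi x' - Phi x = eta * (1 - q) * q ^+ k.
    by rewrite Phix Phix' /level exprS; ring.
  have dPhi0 : 0 < Phi x' - Phi x.
    by rewrite dPhi; apply: mulr_gt0 => //; rewrite mulr_gt0 ?subr_gt0.
  have xx' : x <= x'.
    rewrite leNgt; apply/negP => x'x.
    by move: dPhi0; rewrite subr_gt0 ltNge (Phind _ _ ax' (ltW x'x)).
  set L := stretch p Lam k in Ux; set L' := stretch p Lam k.+1.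
  have /andP[Lge1 LLam] : 1 <= L <= Lam by exact: L_bnd.
  have L0 : 0 < L by exact: lt_le_trans Lge1.
  have dL : L' - L = d * q ^+ k by rewrite /L /L' /stretch -/q /d exprS; ring.
  have d0 : 0 < d by rewrite mulr_gt0 ?subr_gt0.
  have LL' : L <= L' by rewrite -subr_ge0 dL mulr_ge0 ?ltW.
  have x'ge1 : 1 <= x' by rewrite (le_trans a1).
  have delay : d * q ^+ k / (1 + d) <= 1 - expR (L * x' - L' * x').
    apply: (@le_trans _ _ (1 - expR (- (d * q ^+ k)))).
      by apply: onem_expRN_ge; rewrite mulr_ge0 ?(ltW d0) ?(ltW k0)//= ger_pMr.
    rewrite lerD2l lerN2 ler_expR -mulrBl -opprB mulNr lerN2 dL.
    by rewrite ler_peMr// mulr_ge0 ?ltW.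
  have := grow (L * x) (L * x') (L' * x') (mulr_gt0 L0 x0).
  rewrite ler_pM2l// ler_pM2r ?(lt_le_trans ltr01 x'ge1)// => /(_ xx' LL').
  have -> : L' * x' < T.
    apply: le_lt_trans LT; apply: ler_pM => //.
      exact: ltW (lt_le_trans L0 LL').
      exact: le_trans x'ge1.
    by have /andP[] := L_bnd k.+1.
  move=> /(_ isT); apply: le_trans.
  rewrite exprS -mulrA mulr_natl mulr2n lerD//.
  rewrite -[leLHS](doubling_gain p K Lam A k p1 K0 L1 A0) -/q -/d.
  have del0 : 0 <= d * q ^+ k / (1 + d).
    exact: divr_ge0 (mulr_ge0 (ltW d0) (ltW k0)) (addr_ge0 ler01 (ltW d0)).
  apply: ler_pM.
  - by rewrite mulr_ge0 ?powR_ge0.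
  - by rewrite -/eta -dPhi mulr_ge0 ?ltW.
  - apply: ler_pM => //; rewrite ?powR_ge0//.
    have kA0 : 0 <= 2 ^+ k * A by rewrite mulr_ge0 ?exprn_ge0 ?ltW.
    apply: ge0_ler_powR; rewrite ?nnegrE ?(le_trans kA0 Ux)//.
    exact/ltW/(lt_trans ltr01 p1).
  - by rewrite -/eta -dPhi; apply: scal => //; rewrite Lge1.
have tau0 : 0 < tau by exact: lt_le_trans atau.
have Uub k : 2 ^+ k * A <= U (Lam * tau).
  have [x [/andP[ax xt] _] Ux] := step k; apply: le_trans Ux _.
  have /andP[Lk1 Lk2] := L_bnd k.
  have x0 : 0 < x by exact: lt_le_trans ax.
  have L0 : 0 < stretch p Lam k by exact: lt_le_trans Lk1.
  have := grow (stretch p Lam k * x) _ (Lam * tau) (mulr_gt0 L0 x0) (lexx _).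
  by rewrite subrr mulr0 addr0; apply => //; apply: ler_pM => //; exact: ltW.
pose N := (Num.bound (U (Lam * tau) / A)).
have := Uub N; rewrite leNgt => /negP; apply.
rewrite -ltr_pdivrMr//; apply: lt_le_trans (archi_boundP _) _ => //.
  by rewrite divr_ge0 ?ltW// (lt_le_trans A0)// low// LT mulr_gt0.
by rewrite -/N -natrX ler_nat ltnW// ltn_expl.
Qed.

(** * Slices and means on a product space *)

Lemma ge0_RintegralZr d (T : measurableType d) (R : realType)
    (mu : {measure set T -> \bar R}) (f : T -> R) (c : R) :
  measurable_fun setT f -> (forall x, 0 <= f x) -> 0 <= c ->
  \int[mu]_x (f x * c) = \int[mu]_x f x * c.
Proof.
move=> mf f0 c0; rewrite /Rintegral.
have -> : (\int[mu]_x (f x * c)%:E = c%:E * \int[mu]_x (f x)%:E)%E.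
  rewrite -ge0_integralZl_EFin//; last 2 first.
  - by move=> x _; rewrite lee_fin.
  - exact/measurable_EFinP.
  by apply: eq_integral => x _; rewrite mulrC EFinM.
have : (0 <= \int[mu]_x (f x)%:E)%E.
  by apply: integral_ge0 => x _; rewrite lee_fin.
case: (\int[mu]_x (f x)%:E)%E => [r _|_|]//=; first by rewrite mulrC.
rewrite mul0r; move: c0; rewrite le_eqVlt => /predU1P[<-|c0].
  by rewrite mul0e.
by rewrite gt0_muley ?lte_fin.
Qed.

(** Hoelder against the constant 1. *)
Lemma powR_mean_le d (T : measurableType d) (R : realType)
    (mu : probability T R) (p : R) (f : T -> R) :
  1 < p -> measurable_fun setT f ->
  mu.-integrable setT (fun x => (`|f x| `^ p)%:E) ->
  0 <= \int[mu]_x f x -> (\int[mu]_x f x) `^ p <= \int[mu]_x (`|f x| `^ p).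
Proof.
move=> p1 mf fp m0.
have p0 : 0 < p by exact: lt_trans p1.
have q0 : 0 < 1 - p^-1 by rewrite subr_gt0 invf_lt1.
have H := @hoelder _ _ _ mu f (cst 1) p (1 - p^-1)^-1 mf
  (@measurable_cst _ _ _ _ _ _) p0.
have {H} := H ltac:(by rewrite invr_gt0) ltac:(by rewrite invrK addrC subrK).
rewrite Lnorm1 Lnorm_cst1.
rewrite [X in (_ * X)%E](_ : _ = 1%E) ?mule1; last first.
  rewrite -[RHS](poweR1r (1 - p^-1)^-1^-1); congr (_ `^ _)%E.
  exact: probability_setT.
move=> H; have {H} mN : ((\int[mu]_x f x)%:E <= 'N[mu]_p%:E[EFin \o f])%E.
  have fine_le_abs (x : \bar R) : ((fine x)%:E <= `|x|)%E.
    by case: x => [r| |]/=; rewrite ?lee_fin ?ler_norm ?leey.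
  apply: le_trans H; apply: le_trans (fine_le_abs _) _.
  apply: le_trans (le_abse_integral _ _ _) _ => //; first exact/measurable_EFinP.
  by under [leRHS]eq_integral do rewrite /= mulr1.
have := @gt0_ler_poweR _ p (ltW p0) (\int[mu]_x f x)%:E 'N[mu]_p%:E[EFin \o f]%E.
rewrite !in_itv/= !leey !andbT lee_fin m0 Lnorm_ge0 => /(_ isT isT mN).
rewrite poweR_Lnorm ?gt_eqF//= => H.
rewrite -lee_fin; apply: le_trans H _.
by rewrite /Rintegral fineK// integrable_fin_num.
Qed.

(** Fubini on a cylinder, for the real-valued inner integral: the extended one
    may be infinite on a null set, where its real value is 0 by convention,
    and this does not affect integrability. *)
Lemma integrable_slices d1 d2 (T1 : measurableType d1) (T2 : measurableType d2)
    (R : realType) (m1 : {sigma_finite_measure set T1 -> \bar R})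
    (m2 : {sigma_finite_measure set T2 -> \bar R}) (D : set T1)
    (F : T1 * T2 -> R) : measurable D ->
  (m1 \x m2)%E.-integrable (D `*` setT) (EFin \o F) ->
  m1.-integrable D (fun s => (\int[m2]_x F (s, x))%:E) /\
  {ae m1, forall s, D s -> m2.-integrable setT (fun x => (F (s, x))%:E)}.
Proof.
move=> mD iF.
have iF' : (m1 \x m2)%E.-integrable setT ((EFin \o F) \_ (D `*` setT)).
  have mDT : measurable (D `*` [set: T2]) by exact: measurableX.
  by have [+ _] := @integrable_mkcond _ _ _ (m1 \x m2)%E _ (EFin \o F) mDT; exact.
have secE s x : D s -> ((EFin \o F) \_ (D `*` setT)) (s, x) = (F (s, x))%:E.
  by move=> Ds; rewrite patchE mem_set.
have ae : {ae m1, forall s, D s -> m2.-integrable setT (fun x => (F (s, x))%:E)}.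
  apply: filterS (ae_integrable1 iF') => s + Ds.
  by apply: eq_integrable => // x _; rewrite secE.
split=> //.
have iG : m1.-integrable D (fun s => \int[m2]_x (F (s, x))%:E)%E.
  move: (integrable_fubini_F iF').
  move/(integrableS measurableT mD) => /(_ (fun _ _ => I)).
  apply: eq_integrable => // s /[!inE] Ds; rewrite /fubini_F.
  by apply: eq_integral => x _; rewrite secE.
apply: le_integrable (iG) => //.
  apply/measurable_EFinP; apply: measurableT_comp => //.
  exact: measurable_int iG.
move=> s _; rewrite /Rintegral; case: (\int[m2]_x _)%E => [r| |]//=.
- by rewrite normr0 leey.
- by rewrite normr0 leey.
Qed.

(** * The spatial mean of an energy solution *)

Lemma L2_measurable {R : realType} {G : topGroupType}
    (mu : probability (borel G) R) (f : G -> R) :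
  L2 mu f -> measurable_fun setT (f : borel G -> R).
Proof. by rewrite /L2 inE => /andP[/[!inE]]. Qed.

Lemma L2_integrable {R : realType} {G : topGroupType}
    (mu : probability (borel G) R) (f : G -> R) :
  L2 mu f -> mu.-integrable setT (EFin \o (f : borel G -> R)).
Proof.
move=> L2f; apply/Lfun1_integrable.
apply: (Lfun_subset12 (mu := mu)) => //.
by rewrite fin_num_measure.
Qed.

(** The function 1 - e^(s - t), cut off strictly between t and T. *)
Lemma duhamel_test_function {R : realType} (t T : R) : 0 < t < T ->
  exists2 h, elementary h &
   [/\ exists2 T', T' < T & forall s, T' <= s -> h s = 0,
       forall s, s <= t -> h s = 1 - expR (s - t),
       forall s, s <= t -> derive1n 1 h s = - expR (s - t) &
       forall s, s <= t -> derive1n 2 h s = - expR (s - t)].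
Proof.
move=> /andP[t0 tT].
pose c := (t + T) / 2; pose b := (c + T) / 2.
have tc : t < c by rewrite /c; lra.
have cb : c < b by rewrite /b /c; lra.
have bT : b < T by rewrite /b /c; lra.
have [chi echi [chi1 chi0]] := elementary_cutoff c b cb.
pose h s := chi s * (1 + (-1) * expR (s + - t)); exists h.
  apply: elementary_mul => //; apply: elementary_add.
    exact: elementary_cst.
  apply: elementary_mul; first exact: elementary_cst.
  apply: (elementary_comp expR); first exact: elementary_exp.
  by apply: elementary_add; [exact: elementary_id|exact: elementary_cst].
pose k s : R := 1 - expR (s - t).
have hk s : s < c -> \forall x \near s, k x = h x.
  move=> sc; near=> x; rewrite /h chi1 ?mul1r ?mulN1r//.
  by apply/ltW; near: x; exact: lt_nbhsl.
have de s : is_derive s (1 : R) (fun s => expR (s - t)) (expR (s - t)).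
  have d1 : is_derive s (1 : R) (fun s => s - t) (1 - 0).
    exact: (is_deriveB (is_derive_id s 1) (is_derive_cst t s 1)).
  have := @is_derive1_comp _ expR _ s _ _ (is_derive_expR (s - t)) d1.
  by rewrite subr0 mulr1.
have dN s : is_derive s (1 : R) (fun s => - expR (s - t)) (- expR (s - t)).
  exact: is_deriveN.
have dh s : s < c -> derive1 h s = - expR (s - t).
  move=> sc; rewrite derive1E -(near_eq_derive _ (hk s sc)).
  have dk : is_derive s (1 : R) k (0 - expR (s - t)).
    by rewrite /k; apply: is_deriveB.
  by rewrite sub0r in dk; exact: derive_val.
split.
- by exists b => // s bs; rewrite /h chi0 ?mul0r.
- by move=> s st; rewrite /h chi1 ?mul1r ?mulN1r// (le_trans st)// ltW.
- by move=> s st; rewrite derive1n1 dh// (le_lt_trans st).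
- move=> s st; have sc : s < c by exact: le_lt_trans st tc.
  rewrite derive1nS derive1n1 derive1E.
  rewrite -(@near_eq_derive _ _ _ (fun s => - expR (s - t))).
    exact: derive_val.
  near=> x; rewrite dh//; near: x; exact: lt_nbhsl.
Unshelve. all: by end_near. Qed.

Definition source {R : realType} {G : topGroupType}
    (mu : probability (borel G) R) (p : R) (phi : R -> R) (u : R -> G -> R)
    (s : R) : R :=
  \int[mu]_x (phi s * `|u s x| `^ p).

Lemma Rintegral_cst0 d (T : measurableType d) (R : realType)
    (mu : {measure set T -> \bar R}) (D : set T) :
  \int[mu]_(x in D) (0 : R) = 0.
Proof. by rewrite /Rintegral integral0. Qed.

(** The weak identity tested with [duhamel_test_function].  At s = t the test
    function is 0 with derivative -1, so that U t is the only boundary term at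
    time t; on [0, t] its first and second derivatives coincide and the
    Laplacian of a constant vanishes, so that the integral on the left is 0. *)
Lemma duhamel_formula {R : realType} {G : topGroupType} {n : nat}
    (S : lie_structure R G n) (g : chart R G n -> 'rV[R]_n -> 'M[R]_n)
    (mu : probability (borel G) R) (p : R) (phi : R -> R) (eps : R)
    (u0 u1 : G -> R) (u : R -> G -> R) (T t : R) :
  (forall s, 0 <= s -> 0 <= phi s) -> L2 mu u0 -> L2 mu u1 ->
  energy_solution S g mu p phi eps u0 u1 u T -> 0 < t < T ->
  \int[mu]_x u t x =
    eps * \int[mu]_x u0 x + eps * \int[mu]_x u1 x * (1 - expR (- t)) +
    \int[lebesgue_measure]_(s in `[0, t])
      ((1 - expR (s - t)) * source mu p phi u s).
Proof.
move=> phi0 u0L u1L [uH [_ [_ [ut [utL _ _ weak]]]]] tT.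
have /andP[t0 tT'] := tT.
have uL s : 0 <= s < T -> L2 mu (u s) by move=> /uH[].
have [h eh [[T' T'T hT'] h0 h1 h2]] := duhamel_test_function t T tT.
have := weak _ (test_function_time S T T' h eh T'T hT') t tT.
have cstr (f : G -> R) (c : R) : L2 mu f ->
    \int[mu]_x (f x * c) = \int[mu]_x f x * c.
  by move=> /L2_integrable fi; rewrite RintegralZr.
have itvE (s : R) : s \in (`[0, t]%classic : set R) -> 0 <= s <= t.
  by rewrite inE/= in_itv.
rewrite /weak_identity /dt.
have utL2 : L2 mu (u t) by apply: uL; rewrite ltW.
have utL2' : L2 mu (ut t) by apply: utL; rewrite ltW.
rewrite !cstr// h0// !h1// ?(ltW t0)// (h0 0) ?(ltW t0)//.
rewrite subrr expR0 subrr sub0r.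
rewrite [X in _ + X = _](@eq_Rintegral _ _ _ _ _ (fun=> 0)); last first.
  move=> s /itvE/andP[s0 st].
  transitivity (\int[mu]_x (0 : R)); last exact: Rintegral_cst0.
  apply: eq_Rintegral => x _.
  by rewrite laplace_cst h1// h2// subr0 subrr mulr0.
rewrite Rintegral_cst0 [X in _ = X -> _](@eq_Rintegral _ _ _ _ _
    (fun s : measurableTypeR R => (1 - expR (s - t)) * source mu p phi u s));
  last first.
  move=> s /itvE/andP[s0 st].
  rewrite h0// mulrC /source -ge0_RintegralZr//.
  - apply: measurable_funM => //; apply: measurableT_comp (measurable_powR _) _.
    apply: measurableT_comp => //; apply: L2_measurable.
    by apply: uL; rewrite s0 (le_lt_trans st).
  - by move=> x; rewrite mulr_ge0 ?phi0 ?powR_ge0.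
  - by rewrite subr_ge0 expR_le1 subr_le0.
by move=> <-; ring.
Qed.

Lemma integrable_onem_expR {R : realType} (w : R -> R) (t : R) :
  (forall s, 0 <= s -> 0 <= w s) ->
  lebesgue_measure.-integrable `[0, t] (EFin \o w) ->
  lebesgue_measure.-integrable `[0, t]
    (EFin \o (fun s => (1 - expR (s - t)) * w s)).
Proof.
move=> w0 iw; apply: le_integrable (iw) => //.
  apply/measurable_EFinP; apply: measurable_funM; last first.
    by apply/measurable_EFinP; exact: measurable_int iw.
  apply: measurable_funB => //.
  apply: measurableT_comp => //; exact: measurable_funB.
move=> s; rewrite /= in_itv/= => /andP[s0 st]; rewrite lee_fin normrM.
by rewrite ler_piMl// ger0_norm ?subr_ge0 ?expR_le1 ?subr_le0.
Qed.

(** The weight 1 - e^(s - t) increases with t and is at least 1 - e^(m - t) for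
    s <= m. *)
Lemma duhamel_increment {R : realType} (w : R -> R) (r m t : R) :
  (forall s, 0 <= s -> 0 <= w s) ->
  lebesgue_measure.-integrable `[0, t] (EFin \o w) ->
  0 <= r -> r <= m -> m <= t ->
  \int[lebesgue_measure]_(s in `[0, r]) ((1 - expR (s - r)) * w s) +
  (1 - expR (m - t)) * \int[lebesgue_measure]_(s in `]r, m]) w s <=
  \int[lebesgue_measure]_(s in `[0, t]) ((1 - expR (s - t)) * w s).
Proof.
move=> w0 iw r0 rm mt.
have rt : r <= t by exact: le_trans mt.
have m0 : 0 <= m by exact: le_trans rm.
pose k (t s : R) : R := (1 - expR (s - t)) * w s.
rewrite -/(k r) -/(k t).
have sub a b : (BLeft 0 <= a)%O -> (b <= BRight t)%O ->
    [set` Interval a b] `<=` (`[0, t] : set R).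
  by move=> h1 h2; apply: subset_itv.
have ik := integrable_onem_expR w t w0 iw.
have ikr : lebesgue_measure.-integrable `[0, r] (EFin \o k r).
  apply: integrable_onem_expR => //; apply: integrableS iw => //.
  by apply: sub; rewrite bnd_simp.
have itv0 (a b : itv_bound R) : (BLeft 0 <= a)%O -> (b <= BRight t)%O ->
    lebesgue_measure.-integrable [set` Interval a b] (EFin \o k t).
  by move=> h1 h2; apply: integrableS ik => //; exact: sub.
have iwrm : lebesgue_measure.-integrable `]r, m] (EFin \o w).
  by apply: integrableS iw => //; apply: sub; rewrite bnd_simp.
have k0 s : 0 <= s <= t -> 0 <= k t s.
  move=> /andP[s0 st]; rewrite mulr_ge0 ?w0//.
  by rewrite subr_ge0 expR_le1 subr_le0.
have split (a b : R) : 0 <= a -> a <= b -> b <= t ->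
    \int[lebesgue_measure]_(s in `[0, b]) k t s =
    \int[lebesgue_measure]_(s in `[0, a]) k t s +
    \int[lebesgue_measure]_(s in `]a, b]) k t s.
  move=> a0 ab bt; apply/eqP; rewrite addrC -subr_eq; apply/eqP.
  by rewrite Rintegral_itvB ?bnd_simp//; apply: itv0; rewrite bnd_simp.
rewrite (split m t)// (split r m)// -[leLHS]addr0 lerD//; last first.
  apply: Rintegral_ge0 => s /=; rewrite in_itv/= => /andP[ms st].
  by rewrite k0// st andbT (le_trans m0)// ltW.
apply: lerD.
  apply: le_Rintegral => //; first by apply: itv0; rewrite bnd_simp.
  move=> s /=; rewrite in_itv/= => /andP[s0 sr]; rewrite ler_wpM2r ?w0//.
  by rewrite lerD2l lerN2 ler_expR lerD2l lerN2.
rewrite -RintegralZl//; apply: le_Rintegral => //.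
- rewrite (_ : _ \o _ = fun s => ((1 - expR (m - t))%:E * (w s)%:E)%E)//.
  exact: integrableZl.
- by apply: itv0; rewrite bnd_simp.
move=> s /=; rewrite in_itv/= => /andP[rs sm].
have s0 : 0 <= s by rewrite (le_trans r0)// ltW.
rewrite ler_wpM2r ?w0//.
by rewrite lerD2l lerN2 ler_expR lerD2r.
Qed.

Lemma source_ge0 {R : realType} {G : topGroupType}
    (mu : probability (borel G) R) p phi u s :
  0 <= phi s -> 0 <= source mu p phi u s.
Proof.
by move=> phis; rewrite Rintegral_ge0// => x _; rewrite mulr_ge0 ?powR_ge0.
Qed.

(** The lower bound is claimed almost everywhere because the slice of
    phi |u|^p at time s is known to be integrable only for almost every s, and
    the real-valued integral of a slice of infinite integral is 0. *)
Lemma energy_solution_source {R : realType} {G : topGroupType} {n : nat}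
    (S : lie_structure R G n) (g : chart R G n -> 'rV[R]_n -> 'M[R]_n)
    (mu : probability (borel G) R) (p : R) (phi : R -> R) (eps : R)
    (u0 u1 : G -> R) (u : R -> G -> R) (T b : R) :
  1 < p -> (forall s, 0 <= s -> 0 <= phi s) ->
  energy_solution S g mu p phi eps u0 u1 u T -> 0 <= b < T ->
  lebesgue_measure.-integrable `[0, b] (EFin \o source mu p phi u) /\
  {ae lebesgue_measure, forall s, 0 <= s <= b -> 0 <= \int[mu]_x u s x ->
    phi s * (\int[mu]_x u s x) `^ p <= source mu p phi u s}.
Proof.
move=> p1 phi0 [uH [_ [iF _]]] bT; have /andP[b0 _] := bT.
(* Where phi s > 0, integrability of the slice phi s |u s|^p gives that of
   |u s|^p. *)
have [isrc sec] := @integrable_slices _ _ _ _ R lebesgue_measure mu `[0, b]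
  (fun z => phi z.1 * `|u z.1 z.2| `^ p) (measurable_itv _) (iF b bT).
split=> //; apply: filterS sec => s + /[dup] sb /andP[s0 s1] m0.
have uL : L2 mu (u s).
  apply: (proj1 (uH s _)); rewrite s0 (le_lt_trans s1)//.
  by case/andP: bT.
rewrite /= in_itv/= => /(_ sb) iF'.
have := phi0 s s0; rewrite le_eqVlt => /predU1P[phis0|phis].
  by rewrite -phis0 mul0r source_ge0// -phis0.
have iup : mu.-integrable setT (fun x : borel G => (`|u s x| `^ p)%:E).
  rewrite (_ : (fun _ => _) = fun x : borel G =>
    ((phi s)^-1%:E * (phi s * `|u s x| `^ p)%:E)%E); last first.
    by apply/funext => x; rewrite -EFinM mulrA mulVf ?mul1r// gt_eqF.
  exact: integrableZl.
rewrite /source RintegralZl// ler_pM2l//.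
apply: powR_mean_le => //; exact: L2_measurable uL.
Qed.

(** In the Duhamel formula every term is nonnegative and increases with t,
    which gives the lower bound and the monotonicity of the mean.  By
    monotonicity the source is at least phi s (U r)^p for s >= r. *)
Lemma mean_growth {R : realType} {G : topGroupType} {n : nat}
    (S : lie_structure R G n) (g : chart R G n -> 'rV[R]_n -> 'M[R]_n)
    (mu : probability (borel G) R) (p : R) (phi : R -> R) (eps : R)
    (u0 u1 : G -> R) (u : R -> G -> R) (T : R) :
  1 < p -> (forall s, 0 <= s -> 0 <= phi s) -> L1loc_halfline phi ->
  L2 mu u0 -> L2 mu u1 -> 0 < eps ->
  0 < \int[mu]_x u0 x -> 0 < \int[mu]_x u1 x ->
  energy_solution S g mu p phi eps u0 u1 u T ->
  (forall t, 0 < t < T -> eps * \int[mu]_x u0 x <= \int[mu]_x u t x) /\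
  (forall r m t, 0 < r -> r <= m -> m <= t -> t < T ->
    \int[mu]_x u r x + (1 - expR (m - t)) * (\int[mu]_x u r x) `^ p *
      (primitive phi m - primitive phi r) <= \int[mu]_x u t x).
Proof.
move=> p1 phi0 phi_loc u0L u1L eps0 I0 I1 sol.
pose U t := \int[mu]_x u t x; pose w := source mu p phi u.
have duh := @duhamel_formula _ _ _ S g mu p phi eps u0 u1 u T _ phi0 u0L u1L sol.
have w0 s : 0 <= s -> 0 <= w s by move=> s0; apply: source_ge0; exact: phi0.
have low t : 0 < t < T -> eps * \int[mu]_x u0 x <= U t.
  move=> tT; have /andP[t0 _] := tT; rewrite /U duh// -addrA lerDl addr_ge0//.
    apply: mulr_ge0; first by rewrite mulr_ge0 ?ltW.
    by rewrite subr_ge0 expR_le1 oppr_le0 ltW.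
  apply: Rintegral_ge0 => s /=; rewrite in_itv/= => /andP[s0 st].
  by rewrite mulr_ge0 ?w0// subr_ge0 expR_le1 subr_le0.
have U0 t : 0 < t < T -> 0 <= U t.
  by move=> /low; apply: le_trans; rewrite mulr_ge0 ?ltW.
have incr r m t : 0 < r -> r <= m -> m <= t -> t < T ->
    U r + (1 - expR (m - t)) * \int[lebesgue_measure]_(s in `]r, m]) w s <= U t.
  move=> r0 rm mt tT; have rt := le_trans rm mt.
  have t0 := lt_le_trans r0 rt; have rT := le_lt_trans rt tT.
  rewrite /U !duh ?r0 ?t0// -!addrA lerD2l lerD//.
    apply: ler_wpM2l; first by rewrite mulr_ge0 ?ltW.
    by rewrite lerD2l lerN2 ler_expR lerN2.
  apply: duhamel_increment => //; last exact: ltW.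
  have [] := @energy_solution_source _ _ _ S g mu p phi eps u0 u1 u T t p1 phi0 sol.
    by rewrite ltW.
  by [].
have mono r t : 0 < r -> r <= t -> t < T -> U r <= U t.
  move=> r0 rt tT; have := incr r r t r0 (lexx r) rt tT.
  by rewrite set_itv_ge ?bnd_simp// Rintegral_set0 mulr0 addr0.
split=> // r m t r0 rm mt tT; apply: le_trans (incr r m t r0 rm mt tT).
rewrite lerD2l -mulrA ler_wpM2l ?subr_ge0 ?expR_le1 ?subr_le0//.
have mT := le_lt_trans mt tT; have m0 := lt_le_trans r0 rm.
have rT := le_lt_trans rm mT.
have [isrc sec] := @energy_solution_source _ _ _ S g mu p phi eps u0 u1 u T m
  p1 phi0 sol ltac:(by rewrite ltW).
have sub : `]r, m] `<=` (`[0, m] : set R).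
  by apply: subset_itvr; rewrite bnd_simp ltW.
have irm : lebesgue_measure.-integrable `]r, m] (EFin \o w).
  by apply: integrableS isrc.
have iphi : lebesgue_measure.-integrable `]r, m] (EFin \o phi).
  by apply: integrableS (phi_loc m).
have iUphi : lebesgue_measure.-integrable `]r, m]
    (fun s => ((U r) `^ p * phi s)%:E).
  rewrite (_ : (fun _ => _) = fun s => (((U r) `^ p)%:E * (phi s)%:E)%E)//.
  exact: integrableZl.
rewrite (primitiveB _ phi_loc) ?(ltW r0)// -RintegralZl// /Rintegral fine_le//.
- exact: integrable_fin_num iUphi.
- exact: integrable_fin_num irm.
have rm0 s : `]r, m]%classic s -> 0 <= s.
  by rewrite /= in_itv/= => /andP[rs _]; rewrite (le_trans (ltW r0))// ltW.
apply: ae_ge0_le_integral => //.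
- by move=> s /rm0 s0; rewrite lee_fin mulr_ge0 ?powR_ge0 ?phi0.
- exact: measurable_int iUphi.
- by move=> s /rm0 s0; rewrite lee_fin w0.
- exact: measurable_int irm.
have Fae := ae_filter_ringOfSetsType (@lebesgue_measure R).
apply: filterS sec => s H /[dup] /rm0 s0; rewrite /= in_itv/= => /andP[rs sm].
have sT := le_lt_trans sm mT.
have Us : U r <= U s by apply: mono => //; exact: ltW.
have Ur0 : 0 <= U r by apply: U0; rewrite r0.
rewrite lee_fin; apply: le_trans (H _ _); last 2 first.
- by rewrite s0.
- exact: le_trans Us.
rewrite mulrC ler_wpM2l ?phi0// ge0_ler_powR ?nnegrE//.
  exact/ltW/(lt_trans ltr01).
exact: le_trans Us.
Qed.

(** * Lifespan *)

Lemma lifespan_le {R : realType} {G : topGroupType} {n : nat}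
    (S : lie_structure R G n) (g : chart R G n -> 'rV[R]_n -> 'M[R]_n)
    (mu : probability (borel G) R) (u0 u1 : G -> R) (p : R) (phi : R -> R)
    (K lambda0 a Lam eps tau : R) (u : R -> G -> R) :
  L2 mu u0 -> L2 mu u1 ->
  0 < \int[mu]_x u0 x -> 0 < \int[mu]_x u1 x -> 1 < p ->
  (forall s, 0 <= s -> 0 <= phi s) -> L1loc_halfline phi ->
  0 < K -> 0 < lambda0 ->
  (forall lambda s, lambda0 < lambda <= 1 -> a <= s ->
    phi s >= K * phi (lambda * s)) ->
  1 <= a -> 1 < Lam -> Lam < lambda0^-1 -> 0 < eps -> a <= tau ->
  threshold p K Lam * (eps * \int[mu]_x u0 x) `^ (- (p - 1)) <=
    primitive phi tau - primitive phi a ->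
  (lifespan S g mu p phi eps u0 u1 u <= (Lam * tau)%:E)%E.
Proof.
move=> u0L u1L I0 I1 p1 phi0 phi_loc K0 l0 scal a1 L1 Ll eps0 atau thr.
apply: ge_ereal_sup => _ [T [T0 sol] <-]; rewrite lee_fin.
have a0 : 0 <= a by exact: le_trans a1.
have [low grow] := @mean_growth _ _ _ S g mu p phi eps u0 u1 u T
  p1 phi0 phi_loc u0L u1L eps0 I0 I1 sol.
apply: (@delayed_growth_lifespan _ (primitive phi) (fun t => \int[mu]_x u t x)
  T p K Lam a (eps * \int[mu]_x u0 x) tau) => //.
- by rewrite mulr_gt0.
- exact: primitive_continuous.
- by move=> r s ar rs; apply: primitive_nondecreasing => //; exact: le_trans ar.
- move=> L r s /andP[L1' LL] ar rs.
  by apply: (primitive_scaling phi _ _ K lambda0 a) => //; exact: le_lt_trans Ll.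
Qed.

(** The primitive takes every nonnegative value, by the intermediate value
    theorem, and [primitive_inv] selects a nonnegative preimage. *)
Lemma primitive_invK {R : realType} (phi : R -> R) :
  (forall s, 0 <= s -> 0 <= phi s) -> L1loc_halfline phi ->
  ~ lebesgue_measure.-integrable `[0, +oo[ (EFin \o phi) ->
  forall y, 0 <= y ->
    0 <= primitive_inv phi y /\ primitive phi (primitive_inv phi y) = y.
Proof.
move=> phi0 phi_loc nint y y0.
have [t t0 ty] := primitive_unbounded phi phi0 phi_loc nint y.
have cont := primitive_continuous phi phi_loc 0 t (lexx 0).
have [|x] := @IVT _ (primitive phi) 0 t y t0 cont.
  by rewrite primitive0 min_l ?max_r ?y0 ?primitive_ge0.
rewrite in_itv/= => /andP[x0 xt] xy.
have yim : y \in primitive phi @` `[0, +oo[.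
  by rewrite inE; exists x => //; rewrite /= in_itv/= x0.
split; last by rewrite /primitive_inv pinvK.
suff : `[0, +oo[%classic (primitive_inv phi y) by rewrite /= in_itv/= andbT.
apply: (surjpinv_image_sub (f := primitive phi) (B := primitive phi @` `[0, +oo[)).
  exact: subset_refl.
by exists y => //; rewrite -inE.
Qed.

Theorem theorem1p5 (R : realType) (G : topGroupType) (n : nat)
  (S : lie_structure R G n) (G_compact : compact [set: G])
  (g : chart R G n -> 'rV[R]_n -> 'M[R]_n)
  (g_metric : riemannian_metric S g) (g_bi_invariant : bi_invariant S g)
  (mu : probability (borel G) R) (mu_haar : haar mu)
  (u0 u1 : G -> R) (u0_H1 : H1 S g mu u0) (u1_L2 : L2 mu u1)
  (u0_pos : 0 < \int[mu]_x u0 x) (u1_pos : 0 < \int[mu]_x u1 x)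
  (p : R) (p_gt1 : 1 < p)
  (phi : R -> R) (phi_ge0 : forall s, 0 <= s -> 0 <= phi s)
  (phi_loc : L1loc_halfline phi) (phi_scaling : upper_scaling phi)
  (phi_nonint : ~ lebesgue_measure.-integrable `[0, +oo[ (EFin \o phi)) :
  (forall (eps : R) (u : R -> G -> R), 0 < eps ->
     (exists2 T : R, 0 < T & energy_solution S g mu p phi eps u0 u1 u T) ->
     (lifespan S g mu p phi eps u0 u1 u < +oo)%E) /\
  ((forall s, 0 <= s -> 0 < phi s) ->
   exists eps0 c2 C2 : R, [/\ 0 < eps0, 1 < c2, 0 < C2 &
     forall (eps : R) (u : R -> G -> R), 0 < eps <= eps0 ->
       (exists2 T : R, 0 < T & energy_solution S g mu p phi eps u0 u1 u T) ->
       (lifespan S g mu p phi eps u0 u1 u <=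
          (c2 * primitive_inv phi (C2 * eps `^ (- (p - 1))))%:E)%E]).
Proof.
have u0L : L2 mu u0 by case: u0_H1.
have [K [lambda0 [a0 [K0 /andP[l0 l1] a00 scal]]]] := phi_scaling.
pose a := Num.max a0 1; pose Lam := (1 + lambda0^-1) / 2.
have a1 : 1 <= a by rewrite le_max lexx orbT.
have age0 : 0 <= a by exact: le_trans a1.
have l1' : 1 < lambda0^-1 by rewrite invf_gt1.
have L1 : 1 < Lam by rewrite /Lam; lra.
have Ll : Lam < lambda0^-1 by rewrite /Lam; lra.
have scal' lambda s : lambda0 < lambda <= 1 -> a <= s ->
    K * phi (lambda * s) <= phi s.
  by move=> ll as_; apply: scal => //; apply: le_trans as_; rewrite le_max lexx.
set I0 := \int[mu]_x u0 x in u0_pos *.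
have bound eps u tau : 0 < eps -> a <= tau ->
    threshold p K Lam * (eps * I0) `^ (- (p - 1)) <=
      primitive phi tau - primitive phi a ->
    (lifespan S g mu p phi eps u0 u1 u <= (Lam * tau)%:E)%E.
  move=> eps0 atau thr.
  exact: (@lifespan_le _ _ _ S g mu u0 u1 p phi K lambda0 a).
split=> [eps u eps0 _|phi_pos].
  have [t t0 ht] := primitive_unbounded phi phi_ge0 phi_loc phi_nonint
    (primitive phi a + threshold p K Lam * (eps * I0) `^ (- (p - 1))).
  apply: le_lt_trans (bound eps u (Num.max a t) eps0 _ _) (ltry _).
    by rewrite le_max lexx.
  rewrite lerBrDl (le_trans ht)//; apply: primitive_nondecreasing => //.
  by rewrite le_max lexx orbT.
(* The lifespan estimate asks for Phi tau - Phi a >= D eps^(-(p-1)).  With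
   Phi tau = 2 D eps^(-(p-1)) this holds as soon as D eps^(-(p-1)) >= Phi a;
   eps0 provides Phi a + 1 instead, so that moreover tau > a. *)
pose D := threshold p K Lam * I0 `^ (- (p - 1)).
have D0 : 0 < D by rewrite mulr_gt0 ?threshold_gt0 ?powR_gt0.
have Pa0 : 0 <= primitive phi a by exact: primitive_ge0.
have Pa1 : 0 < primitive phi a + 1 by exact: ltr_wpDl.
have p10 : 0 < p - 1 by rewrite subr_gt0.
exists ((D / (primitive phi a + 1)) `^ (p - 1)^-1), Lam, (2 * D).
split=> //.
- by rewrite powR_gt0// divr_gt0.
- by rewrite mulr_gt0.
move=> eps u /andP[eps0 epsle] _; set y := eps `^ (- (p - 1)).
have y0 : 0 < y by rewrite powR_gt0.
have Dy : primitive phi a + 1 <= D * y.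
  have : eps `^ (p - 1) <= D / (primitive phi a + 1).
    have -> : D / (primitive phi a + 1) =
        ((D / (primitive phi a + 1)) `^ (p - 1)^-1) `^ (p - 1).
      by rewrite -powRrM mulVf ?gt_eqF// powRr1// divr_ge0 ?ltW.
    by apply: ge0_ler_powR; rewrite ?nnegrE ?powR_ge0// ltW.
  rewrite ler_pdivlMr// mulrC -ler_pdivlMr ?powR_gt0//.
  by rewrite /y powRN.
have [] := primitive_invK phi phi_ge0 phi_loc phi_nonint (2 * D * y).
  exact: mulr_ge0 (mulr_ge0 (ler0n _ 2) (ltW D0)) (ltW y0).
set tau := primitive_inv phi _ => tau0 tauE.
apply: bound => //.
  rewrite leNgt; apply/negP => tau_a.
  have := primitive_nondecreasing phi phi_ge0 phi_loc tau a tau0 (ltW tau_a).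
  by rewrite tauE; lra.
rewrite tauE powRM ?(ltW eps0) ?(ltW u0_pos)// -/y.
rewrite [leLHS](_ : _ = D * y); last by rewrite /D; ring.
lra.
Qed.
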